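(* Let $m$ be a positive integer, let $G$ be an $m$-boundedly generated group, and let $L \leq G$ be a subgroup of finite index $n$. Then $$\mathrm{rank}(L) \leq 2m^2\sqrt{n\log(n)} + m.$$ If in addition $L$ is normal in $G$, then $$\mathrm{rank}(L) \leq m\log_2(n) + m.$$
   Context: For a positive integer $m$, a group $G$ is called $m$-boundedly generated if there exist $g_1, \dots, g_m \in G$ such that $G = \langle g_1 \rangle \cdots \langle g_m \rangle$ as sets, i.e. every element of $G$ can be written as $g_1^{a_1} \cdots g_m^{a_m}$ for some integers $a_1, \dots, a_m$. The rank $\mathrm{rank}(L)$ of a group $L$ is the smallest cardinality of a generating set of $L$. Here $\log$ denotes the natural logarithm and $\log_2$ the logarithm to base $2$. *)

(* Defs.v *)
From mathcomp Require Import all_boot all_order all_algebra.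
From mathcomp Require Import all_classical all_reals all_analysis.

Set Implicit Arguments.
Unset Strict Implicit.
Unset Printing Implicit Defensive.

Local Open Scope classical_set_scope.
Local Open Scope card_scope.
Local Open Scope group_scope.

(* Groups are arbitrary, possibly infinite: the library's [groupType], with
   subgroups represented as classical sets. *)

Definition subgroup (G : groupType) (L : set G) : Prop := group_closed [in L].

Definition normal_subgroup (G : groupType) (L : set G) : Prop :=
  subgroup L /\ forall x g : G, L x -> L (x ^ g).

Definition expgz (G : groupType) (x : G) (a : int) : G :=
  match a with
  | Posz k => x ^+ k
  | Negz k => x ^- k.+1
  end.

(* The product is taken in increasing order of the index. *)
Definition boundedly_generated (m : nat) (G : groupType) : Prop :=
  exists g : 'I_m -> G, forall x : G,
    exists a : 'I_m -> int, x = \prod_(i < m) expgz (g i) (a i).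

Definition left_cosets (G : groupType) (L : set G) : set (set G) :=
  [set [set x * y | y in L] | x in [set: G]].

(* L has finite index, equal to n. *)
Definition has_index (G : groupType) (L : set G) (n : nat) : Prop :=
  left_cosets L #= `I_n.

Definition generated (G : groupType) (S : set G) : set G :=
  smallest (@subgroup G) S.

(* L has finite rank, equal to r; competing generating sets may be infinite. *)
Definition has_rank (G : groupType) (L : set G) (r : nat) : Prop :=
  (exists S : set G, generated S = L /\ S #= `I_r) /\
  (forall S : set G, generated S = L -> `I_r #<= S).

(* Main.v *)
(* Write an element of [G] as [g_1^a_1 * ... * g_m^a_m] and reduce the exponents
   one after the other: if [y] is the reduced prefix, then [y * g_i^d * y^-1] is
   in [L] for some [0 < d <= n], so only the residue of [a_i] modulo [d] matters
   up to left multiplication by a power of this element of [L].  Hence [G] is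
   covered by [n ^ m] right cosets of [m]-generated subgroups of [L], and by
   B.H. Neumann's lemma one of these subgroups has index at most [n ^ m] in [G].
   Each generator added to it halves the index, so
   [rank L <= m + m * log_2 n] whether or not [L] is normal; the first bound
   follows from [ln n <= sqrt (n * ln n)] and [1 <= 2 * ln 2]. *)

Require Import Defs.
From mathcomp Require Import all_boot all_order all_algebra.
From mathcomp Require Import all_classical all_reals all_analysis.
From mathcomp Require Import ring lra.

Set Implicit Arguments.
Unset Strict Implicit.
Unset Printing Implicit Defensive.

Import Order.TTheory GRing.Theory Num.Theory.

Local Open Scope classical_set_scope.
Local Open Scope card_scope.
Local Open Scope group_scope.

(** * Subgroups as classical sets *)

Lemma subgroup1 (G : groupType) (H : set G) : subgroup H -> H 1.
Proof. by move=> [/set_mem]. Qed.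

Lemma subgroup_div (G : groupType) (H : set G) (x y : G) :
  subgroup H -> H x -> H y -> H (x / y).
Proof. by move=> [_ HB] Hx Hy; apply/set_mem/HB; apply/mem_set. Qed.

Lemma subgroupV (G : groupType) (H : set G) (x : G) :
  subgroup H -> H x -> H x^-1.
Proof.
by move=> sH Hx; rewrite -[x^-1]mul1g; apply: subgroup_div => //; apply: subgroup1.
Qed.

Lemma subgroupM (G : groupType) (H : set G) (x y : G) :
  subgroup H -> H x -> H y -> H (x * y).
Proof.
by move=> sH Hx Hy; rewrite -[y]invgK; apply: subgroup_div => //; apply: subgroupV.
Qed.

Lemma subgroupX (G : groupType) (H : set G) (x : G) (k : nat) :
  subgroup H -> H x -> H (x ^+ k).
Proof.
move=> sH Hx; elim: k => [|k IH]; first exact: subgroup1.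
by rewrite expgS; apply: subgroupM.
Qed.

Lemma subgroupI (G : groupType) (H K : set G) :
  subgroup H -> subgroup K -> subgroup (H `&` K).
Proof.
move=> sH sK; split=> [|x y /set_mem[Hx Kx] /set_mem[Hy Ky]]; apply/mem_set.
  by split; apply: subgroup1.
by split; apply: subgroup_div.
Qed.

Lemma subgroup_generated (G : groupType) (S : set G) : subgroup (generated S).
Proof.
split=> [|x y /set_mem Sx /set_mem Sy]; apply/mem_set => A [sA SA].
  exact: subgroup1.
by apply: subgroup_div => //; [apply: Sx|apply: Sy].
Qed.

Lemma generated_cons (G : groupType) (x : G) (s : seq G) :
  generated [set` s] `<=` generated [set` x :: s].
Proof.
apply: smallest_sub; first exact: subgroup_generated.
by move=> y /= ys; apply: sub_gen_smallest; rewrite /= inE ys orbT.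
Qed.

(** * Right cosets, coset covers and transversals *)

Definition right_coset (G : groupType) (H : set G) (x : G) : set G :=
  [set y | H (y * x^-1)].

Lemma right_coset_eqP (G : groupType) (H : set G) {x y : G} :
  subgroup H -> (right_coset H x = right_coset H y) <-> H (x * y^-1).
Proof.
move=> sH; split=> [E|Hxy].
  have : right_coset H x x by rewrite /right_coset /= mulgV; apply: subgroup1.
  by rewrite E.
apply/seteqP; split=> z /=; rewrite /right_coset /= => Hz.
  by rewrite -(mulgVK x z) -mulgA; apply: subgroupM.
rewrite -(mulgVK y z) -mulgA; apply: subgroupM => //.
by rewrite -[y * _]invgK invgM invgK; apply: subgroupV.
Qed.

(** Finite index is expressed as [exists s, coset_cover H s]. The list may be redundant, so [size s]
    only bounds the index from above. *)
Definition coset_cover (G : groupType) (H : set G) (s : seq G) : Prop :=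
  forall x, exists2 y, y \in s & H (x * y^-1).

Lemma coset_coverS (G : groupType) (H K : set G) (s : seq G) :
  H `<=` K -> coset_cover H s -> coset_cover K s.
Proof. by move=> HK Hs x; have [y ys Hxy] := Hs x; exists y => //; apply: HK. Qed.

Lemma coset_cover_gt0 (G : groupType) (H : set G) (s : seq G) :
  coset_cover H s -> (0 < size s)%N.
Proof. by move=> /(_ 1)[y]; case: s. Qed.

(** Dual to [coset_cover]: here [size s] is a lower bound for the index. *)
Definition coset_indep (G : groupType) (H : set G) (s : seq G) : bool :=
  uniq [seq right_coset H x | x <- s].

Lemma coset_indepP (G : groupType) (H : set G) (s : seq G) :
  subgroup H ->
  coset_indep H s <->
  uniq s /\ forall x y, x \in s -> y \in s -> H (x * y^-1) -> x = y.
Proof.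
move=> sH; rewrite /coset_indep; split=> [us|[us inj]].
  split=> [|x y xs ys /(right_coset_eqP sH)]; first exact: map_uniq us.
  move=> Exy; move: us; rewrite /coset_indep.
  move=> /(uniqP set0) /(_ (index x s) (index y s)).
  rewrite !inE size_map !index_mem !(nth_map 1) ?index_mem // !nth_index // Exy.
  by move=> /(_ xs ys erefl) E; rewrite -(nth_index 1 xs) E nth_index.
rewrite map_inj_in_uniq // => x y xs ys /(right_coset_eqP sH); exact: inj.
Qed.

Lemma coset_indep_size (G : groupType) (H : set G) (s t : seq G) :
  subgroup H -> coset_cover H s -> coset_indep H t -> (size t <= size s)%N.
Proof.
move=> sH Hs ut; rewrite -(size_map (right_coset H) t) -(size_map (right_coset H) s).
apply: uniq_leq_size => // _ /mapP[x _ ->].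
have [y ys /(right_coset_eqP sH) ->] := Hs x.
exact: map_f.
Qed.

Lemma coset_transversal (G : groupType) (H : set G) (s : seq G) :
  subgroup H -> coset_cover H s ->
  exists t, coset_cover H t /\ coset_indep H t.
Proof.
move=> sH Hs.
have [t [ut st]] : exists t, coset_indep H t /\
    forall x, x \in s -> exists2 y, y \in t & H (x * y^-1).
  elim: s {Hs} => [|x s [t [ut st]]]; first by exists [::].
  have [xt|xt] := boolP (right_coset H x \in [seq right_coset H y | y <- t]).
    exists t; split=> // z /[!inE] /predU1P[->|/st //].
    by have /mapP[y yt /(right_coset_eqP sH)] := xt; exists y.
  exists (x :: t); split=> [|z /[!inE] /predU1P[->|/st[y yt Hy]]].
  - by rewrite /coset_indep /= xt.
  - by exists x; rewrite ?inE ?eqxx // mulgV; apply: subgroup1.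
  - by exists y; rewrite // inE yt orbT.
exists t; split=> // x; have [y /st[z zt Hyz] Hxy] := Hs x.
by exists z; rewrite // -(mulgVK y x) -mulgA; apply: subgroupM.
Qed.

Lemma coset_coverI (G : groupType) (H K : set G) (s t : seq G) :
  subgroup H -> subgroup K -> coset_cover H s -> coset_cover K t ->
  exists u, coset_cover (H `&` K) u.
Proof.
move=> sH sK Hs Kt.
pose c a b := xget 1 [set z : G | H (z * a^-1) /\ K (z * b^-1)].
exists [seq c a b | a <- s, b <- t] => x.
have [a sa Ha] := Hs x; have [b tb Kb] := Kt x.
exists (c a b); first exact: allpairs_f.
have [Hc Kc] : [set z : G | H (z * a^-1) /\ K (z * b^-1)] (c a b).
  by apply: (xgetI 1 (x := x)).
split; [rewrite -(mulgKA a^-1 x) | rewrite -(mulgKA b^-1 x)]; exact: subgroup_div.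
Qed.

(** * B.H. Neumann's lemma on coverings by cosets *)

(** A pair [(H, s)] stands for the union of the cosets of [H] at the elements of [s]. If [s] misses
    a coset of [H], the other pairs cover that coset, and enough translates of them replace
    [(H, s)]. This alters the tail of [l], so the induction is on its length. *)
Lemma cover_finite_index (G : groupType) (l : seq (set G * seq G)) :
  (forall p, p \in l -> subgroup p.1) ->
  (forall x, exists2 p, p \in l & exists2 y, y \in p.2 & p.1 (x * y^-1)) ->
  exists2 p, p \in l & exists s, coset_cover p.1 s.
Proof.
elim: {l}(size l) {-2}l (erefl (size l)) => [|k IH] [|[H s] l] //= => [_|[lk]] sl cl.
  by have [] := cl 1.
have [Hs|nHs] := pselect (coset_cover H s).
  by exists (H, s); [rewrite inE eqxx | exists s].
have sH : subgroup H by apply: (sl (H, s)); rewrite inE eqxx.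
have [z Hz] : exists z, forall y, y \in s -> ~ H (z * y^-1).
  apply/not_existsP => nz; apply: nHs => x.
  by apply: contrapT => nx; apply: (nz x) => y ys Hy; apply: nx; exists y.
(* Since [Hz] meets no [Hy] with [y] in [s], it lies in the cosets of [l], and
   so does every [Hy] after a right translation by [z^-1 * y]. *)
pose ext (p : set G * seq G) :=
  (p.1, p.2 ++ [seq y' * z^-1 * y | y <- s, y' <- p.2]).
have [|p /mapP[q ql ->]|x|_ /mapP[q ql ->] [t qt]] := IH [seq ext p | p <- l].
- by rewrite size_map.
- by apply: (sl q); rewrite inE ql orbT.
- have [[K t] /[!inE] /predU1P[[-> ->]|Kl] [y /= yt Ky]] := cl x; last first.
    exists (ext (K, t)); first exact: map_f.
    by exists y => //=; rewrite mem_cat yt.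
  have [[K' t'] /[!inE] /predU1P[[-> ->]|Kl] [y' /= yt' Ky']] := cl (x * y^-1 * z).
    have /(Hz _ yt')[] : H (z * y'^-1).
    rewrite -(mulKg (x / y) (z / y')).
    by apply: subgroupM => //; [apply: subgroupV|rewrite mulgA].
  exists (ext (K', t')); first exact: map_f.
  exists (y' * z^-1 * y) => /=.
    by rewrite mem_cat; apply/orP; right; apply: (allpairs_f (fun y y' => y' * z^-1 * y)).
  by rewrite !invgM invgK !mulgA in Ky' *.
- by exists q; [rewrite inE ql orbT | exists t].
Qed.

Lemma leq_sum_count (T : Type) (I : eqType) (P : I -> pred T) (l : seq I) (s : seq T) :
  all (fun x => has (P^~ x) l) s -> (size s <= \sum_(i <- l) count (P i) s)%N.
Proof.
elim: s => [|x s IH] //= /andP[/hasP[i il Pix] /IH les].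
by rewrite big_split /= -add1n leq_add // (big_rem i il) /= Pix.
Qed.

Lemma has_asboolP (T : eqType) (P : T -> Prop) (s : seq T) :
  reflect (exists2 x, x \in s & P x) (has (fun x => `[< P x >]) s).
Proof.
apply: (iffP hasP) => -[x xs Px]; exists x => //; exact/asboolP.
Qed.

(** The cosets of infinite index can be discarded; the others are unions of cosets of one subgroup
    [D] of finite index. If all indices exceeded [size l], each coset would contain less than a
    fraction [1 / size l] of the cosets of [D], too few for a cover. *)
Lemma neumann_cover (G : groupType) (l : seq (set G * G)) :
  (forall p, p \in l -> subgroup p.1) ->
  (forall x, exists2 p, p \in l & p.1 (x * p.2^-1)) ->
  exists2 p, p \in l & exists2 s, coset_cover p.1 s & (size s <= size l)%N.
Proof.
move=> sl cl.
pose fin (p : set G * G) := `[< exists s, coset_cover p.1 s >].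
(* [D] is the intersection of the subgroups of finite index in [l]. *)
have [D [sD Dfin [u Du]]] : exists D : set G, [/\ subgroup D,
    forall p, p \in l -> fin p -> D `<=` p.1 & exists u, coset_cover D u].
  elim: l sl {cl} => [|q l IH] sl.
    exists setT; split=> //; last by exists [:: 1] => x; exists 1; rewrite ?inE.
    by split=> [|? ? _ _]; rewrite in_setT.
  have [|D [sD Dfin [u Du]]] := IH; first by move=> p pl; apply: sl; rewrite inE pl orbT.
  have [/asboolP[s qs]|nq] := boolP (fin q); last first.
    exists D; split=> //; last by exists u.
    by move=> p /[!in_cons] /predU1P[-> qf|/Dfin//]; rewrite qf in nq.
  have sq : subgroup q.1 by apply: sl; rewrite inE eqxx.
  exists (D `&` q.1); split; first exact: subgroupI.
    by move=> p /[!in_cons] /predU1P[-> _|pl pf] x [Dx qx] //; apply: (Dfin p).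
  exact: (coset_coverI sD sq Du qs).
have {}cl x : exists2 p, p \in [seq q <- l | fin q] & p.1 (x * p.2^-1).
  apply: contrapT => nx.
  (* The coset [Dx] avoids the cosets of finite index, hence finitely many
     translates of the cosets of infinite index cover [G]. *)
  pose I := [seq (p.1, [seq p.2 * x^-1 * w | w <- u]) | p <- l & ~~ fin p].
  have [_ /mapP[p pl ->]|y|_ /mapP[p /[!mem_filter] /andP[/asboolP npf _] ->]] :=
    @cover_finite_index G I.
  - by move: pl; rewrite mem_filter => /andP[_ /sl].
  - have [w wu Dw] := Du y; have [p pl px] := cl (y * w^-1 * x).
    have [pf|pf] := boolP (fin p).
      case: nx; exists p; first by rewrite mem_filter pf.
      rewrite -(mulKg (y / w) (x / p.2)); apply: subgroupM; first exact: sl.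
        by apply: subgroupV; [exact: sl|exact: (Dfin p)].
      by rewrite mulgA.
    exists (p.1, [seq p.2 * x^-1 * w | w <- u]).
      by apply/mapP; exists p; rewrite // mem_filter pf.
    by exists (p.2 * x^-1 * w); [exact: map_f|rewrite /= !invgM invgK !mulgA in px *].
  - by move=> [t pt]; apply: npf; exists t.
have [t [Dt ut]] := coset_transversal sD Du.
pose P (p : set G * G) x := `[< p.1 (x * p.2^-1) >].
apply: contrapT => small.
have big p s : p \in [seq q <- l | fin q] -> coset_cover p.1 s -> (size l < size s)%N.
  rewrite mem_filter => /andP[_ pl] ps; rewrite ltnNge; apply/negP => le.
  by apply: small; exists p => //; exists s.
(* If [v] is a transversal for [p.1] and [x] runs through the elements of [t] in
   the coset [p.1 * p.2], the elements [x * p.2^-1 * w] with [w] in [v] lie in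
   distinct cosets of [D]. *)
have count_le p : p \in [seq q <- l | fin q] -> ((size l).+1 * count (P p) t <= size t)%N.
  move=> pf; have := pf; rewrite mem_filter => /andP[finp pl].
  have sp := sl _ pl; have [s ps] := asboolP _ finp.
  have [v [pv uv]] := coset_transversal sp ps.
  apply: leq_trans (_ : size v * size [seq z <- t | P p z] <= _)%N.
    by rewrite size_filter leq_mul2r (big p v) // orbT.
  rewrite -(size_allpairs (fun w x => x * p.2^-1 * w)).
  apply: (coset_indep_size sD Dt); apply/(coset_indepP _ sD).
  have [tu tD] := (coset_indepP t sD).1 ut; have [vu vp] := (coset_indepP v sp).1 uv.
  have key w x w' x' : w \in v -> x \in [seq z <- t | P p z] -> w' \in v ->
      x' \in [seq z <- t | P p z] -> D (x * p.2^-1 * w * (x' * p.2^-1 * w')^-1) ->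
      (w, x) = (w', x').
    rewrite !mem_filter => wv /andP[/asboolP px xt] w'v /andP[/asboolP px' x't] Dxw.
    have ww : w = w'.
      apply: vp => //; rewrite -(mulKg (x / p.2) (w / w')).
      apply: subgroupM => //; first exact: subgroupV.
      rewrite -[X in p.1 X](mulgK (x' * p.2^-1)^-1) invgK.
      apply: subgroupM => //; apply: Dfin pl finp _ _.
      by rewrite !invgM !mulgA in Dxw *.
    congr pair => //; apply: tD => //.
    by move: Dxw; rewrite ww !mulgKA.
  split; last first.
    move=> _ _ /allpairsP[[w x] /= [wv xt ->]] /allpairsP[[w' x'] /= [wv' xt' ->]].
    by move=> Dxw; have [-> ->] := key _ _ _ _ wv xt wv' xt' Dxw.
  apply: allpairs_uniq => //; first exact: filter_uniq.
  move=> _ _ /allpairsP[[w x] /= [wv xt ->]] /allpairsP[[w' x'] /= [wv' xt' ->]] E.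
  by apply: key => //=; rewrite E mulgV; apply: subgroup1.
have t_gt0 := coset_cover_gt0 Dt.
(* Summing [count_le] over the cosets of finite index, at most [size l] in number, gives the
   contradiction. *)
have : ((size l).+1 * size t <= size l * size t)%N.
  apply: (@leq_trans ((size l).+1 * \sum_(p <- [seq q <- l | fin q]) count (P p) t)).
    rewrite leq_mul2l /=; apply: leq_sum_count; apply/allP => x _.
    by apply/has_asboolP; apply: cl.
  rewrite big_distrr /= big_seq.
  apply: leq_trans (leq_sum _ (fun p pf => count_le p pf)) _.
  rewrite -big_seq big_const_seq iter_addn_0 count_predT mulnC leq_mul2r.
  by rewrite size_filter count_size orbT.
by rewrite leq_mul2r ltnn orbF => /eqP t0; rewrite t0 in t_gt0.
Qed.

(** * Completing a generating set *)

(** As long as some [z] in [L] is missed, adjoining it at least halves the size of a coset cover,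
    whence the power of 2. *)
Lemma generated_extend (G : groupType) (L : set G) (hs s : seq G) :
  subgroup L -> generated [set` hs] `<=` L -> coset_cover (generated [set` hs]) s ->
  exists ts, generated [set` ts ++ hs] = L /\ (2 ^ size ts <= size s)%N.
Proof.
move=> sL; have [k] := ubnP (size s); elim: k s hs => // k IH s hs sk hsL hss.
have [E|ne] := pselect (generated [set` hs] = L).
  by exists [::]; split=> //; apply: coset_cover_gt0 hss.
have [z Lz nz] : exists2 z, L z & ~ generated [set` hs] z.
  apply: contrapT => nex; apply: ne; apply/seteqP; split=> // z Lz.
  by apply: contrapT => nz; apply: nex; exists z.
set H := generated [set` hs] in hsL hss nz.
have sH : subgroup H := subgroup_generated _.
set K := generated [set` z :: hs].
have sK : subgroup K := subgroup_generated _.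
have HK : H `<=` K := @generated_cons G z hs.
have Kz : K z by apply: sub_gen_smallest; rewrite /= inE eqxx.
have [t [Kt ut]] := coset_transversal sK (coset_coverS HK hss).
have [tu tK] := (coset_indepP t sK).1 ut.
(* With [t] a transversal of [K], the elements [y] and [z * y], for [y] in [t], lie in distinct
   cosets of [H], because [z] is in [K] but not in [H]. *)
have t2 : (size t * 2 <= size s)%N.
  have -> : (size t * 2)%N = size (t ++ [seq z * y | y <- t]).
    by rewrite size_cat size_map muln2 addnn.
  apply: (coset_indep_size sH hss); rewrite /coset_indep map_cat cat_uniq.
  apply/and3P; split.
  - by apply/(coset_indepP t sH); split=> // x y xt yt /HK; apply: tK.
  - apply/hasPn => _ /mapP[_ /mapP[y yt ->] ->]; apply/negP => /mapP[x xt].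
    move=> /(right_coset_eqP sH) Hzyx; apply: nz.
    have xy : y = x.
      apply: tK => //; rewrite -(mulKg z (y / x)).
      by apply: (subgroupM sK); [exact: (subgroupV sK)|apply: HK; rewrite mulgA].
    by rewrite xy mulgK in Hzyx.
  - rewrite -map_comp map_inj_in_uniq // => x y xt yt /= /(right_coset_eqP sH).
    move=> /HK Kzz; apply: tK => //.
    rewrite -(mulKg z (x / y)) -[X in K X](mulgVK z).
    apply: (subgroupM sK) => //; rewrite -mulgA.
    apply: (subgroupM sK); first exact: (subgroupV sK).
    by rewrite invgM !mulgA in Kzz *.
have t_gt0 := coset_cover_gt0 Kt.
have [||ts [E ht]] := IH t (z :: hs) _ _ Kt.
- rewrite -ltnS; apply: leq_trans sk; rewrite ltnS.
  by apply: leq_trans t2; rewrite muln2 -addnn -[X in (X < _)%N]addn0 ltn_add2l.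
- apply: smallest_sub => // y /=; rewrite inE => /predU1P[->//|yhs].
  by apply: hsL; apply: sub_gen_smallest.
exists (rcons ts z); rewrite cat_rcons size_rcons expnSr; split=> //.
by apply: leq_trans t2; rewrite leq_mul2r.
Qed.

(** * Reduction of exponents in bounded products *)

Lemma conj_expg (G : groupType) (x y : G) (k : nat) :
  (y * x * y^-1) ^+ k = y * x ^+ k * y^-1.
Proof.
by have := conjXg x y^-1 k; rewrite !conjgE invgK !mulgA.
Qed.

(** Pigeonhole: two of the elements [y * g ^+ i] with [0 <= i <= size s] share a right coset of [L],
    and [o] is the difference of their exponents. *)
Lemma conj_expg_mem (G : groupType) (L : set G) (s : seq G) (y g : G) :
  subgroup L -> coset_cover L s ->
  exists o, [/\ (0 < o)%N, (o <= size s)%N & L (y * g ^+ o * y^-1)].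
Proof.
move=> sL Ls; pose t := [seq y * g ^+ i | i <- iota 0 (size s).+1].
have : ~~ coset_indep L t.
  apply/negP => /(coset_indep_size sL Ls).
  by rewrite size_map size_iota ltnn.
rewrite /coset_indep => /(uniqPn set0)[i [j [ij]]].
rewrite !size_map size_iota => js.
have iS := ltn_trans ij js.
rewrite !(nth_map 1) ?size_map ?size_iota // !(nth_map 0%N) ?size_iota // !nth_iota //.
rewrite !add0n => E.
have /(right_coset_eqP sL) Lij := esym E.
exists (j - i)%N; rewrite subn_gt0 ij; split=> //.
  by rewrite (leq_trans (leq_subr i j)).
by rewrite expgnFr ?(ltnW ij) // ; rewrite invgM !mulgA in Lij *.
Qed.

(** With [b] the residue of [a] modulo [o], the element in question is a power of
    [y * g ^+ o * y^-1]. The residue is chosen before [K], since the subgroup used later depends on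
    it. *)
Lemma expgz_modn (G : groupType) (g : G) (a : int) (o : nat) : (0 < o)%N ->
  exists b, (b < o)%N /\
    forall (K : set G) (y : G), subgroup K -> K (y * g ^+ o * y^-1) ->
      K (y * expgz g a * (y * g ^+ b)^-1).
Proof.
move=> o0; case: a => k /=.
  exists (k %% o)%N; split; first exact: ltn_pmod.
  move=> K y sK Ko; rewrite {1}(divn_eq k o) expgnDr mulgA invgM mulgA mulgK.
  by rewrite mulnC expgnA -conj_expg; apply: subgroupX.
(* Here [a = - (k + 1)], and [a - b = - o * (k %/ o + 1)]; hence the passage to inverses below. *)
exists (o - (k %% o).+1)%N; have ko := ltn_pmod k o0.
split; first by rewrite ltn_subrL o0.
move=> K y sK Ko.
rewrite -[X in K X]invgK; apply: (subgroupV sK).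
rewrite !invgM !invgK mulgA -(mulgA y) -expgnDr.
have -> : (o - (k %% o).+1 + k.+1 = o * (k %/ o).+1)%N.
  by rewrite {2}(divn_eq k o) -addnS addnCA subnK // mulnS addnC mulnC.
by rewrite expgnA -conj_expg; apply: subgroupX.
Qed.

(** The prefix [y] is arbitrary so that the induction can continue with [y * g ord0 ^+ b]. Each step
    branches over at most [size s] residues [b] and adds one generator, the conjugate [x] below. *)
Lemma bounded_product_cover (G : groupType) (L : set G) (s : seq G) :
  subgroup L -> coset_cover L s ->
  forall (m : nat) (g : 'I_m -> G) (y : G), exists l : seq (seq G * G),
    [/\ (size l <= size s ^ m)%N,
        forall p, p \in l -> size p.1 = m /\ [set` p.1] `<=` L
      & forall a : 'I_m -> int, exists2 p, p \in l &
          generated [set` p.1] (y * \prod_(i < m) expgz (g i) (a i) * p.2^-1)].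
Proof.
move=> sL Ls; elim=> [|m IH] g y.
  exists [:: ([::], y)]; split=> // [p|a]; first by rewrite inE => /eqP ->.
  exists ([::], y); rewrite ?inE // big_ord0 mulg1 mulgV.
  exact: subgroup1 (subgroup_generated _).
have [d [d0 ds Ld]] := conj_expg_mem y (g ord0) sL Ls.
have /choice[F FP] := fun b : nat => IH (g \o lift ord0) (y * g ord0 ^+ b).
pose x := y * g ord0 ^+ d * y^-1.
exists [seq (x :: p.1, p.2) | b <- iota 0 d, p <- F b]; split.
- rewrite size_allpairs_dep sumnE big_map expnS.
  apply: (@leq_trans (\sum_(b <- iota 0 d) size s ^ m)).
    by apply: leq_sum => b _; case: (FP b).
  by rewrite big_const_seq iter_addn_0 count_predT size_iota mulnC leq_mul2r ds orbT.
- move=> _ /allpairsPdep[b [p [_ pF ->]]] /=; have [_ /(_ _ pF)[-> pL] _] := FP b.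
  by split=> // h /=; rewrite inE => /predU1P[->//|]; apply: pL.
- move=> a. have [b [bd bP]] := expgz_modn (g ord0) (a ord0) d0.
  have [_ _ /(_ (fun i => a (lift ord0 i)))[p pF pP]] := FP b.
  exists (x :: p.1, p.2).
    by apply/allpairsPdep; exists b, p; rewrite mem_iota.
  set K := generated _.
  have sK : subgroup K := subgroup_generated _.
  rewrite big_ord_recl /=; set P := \prod_(i < m) _.
  (* The first factor is a power of [x]; the second is covered by the induction hypothesis for the
     prefix [y * g ord0 ^+ b]. *)
  have -> : y * (expgz (g ord0) (a ord0) * P) * p.2^-1 =
      (y * expgz (g ord0) (a ord0) * (y * g ord0 ^+ b)^-1) *
      (y * g ord0 ^+ b * P * p.2^-1).
    by move: (y * g ord0 ^+ b) => u; rewrite !mulgA mulgVK.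
  apply: (subgroupM sK); last exact: (@generated_cons _ x _ _ pP).
  by apply: bP sK _; apply: sub_gen_smallest; rewrite /= inE eqxx.
Qed.

(** * Index and rank as cardinalities *)

(** [has_index] counts left cosets, [coset_cover] uses right ones; inverting the representatives
    exchanges the two. *)
Lemma has_index_cover (G : groupType) (L : set G) (n : nat) :
  subgroup L -> has_index L n -> exists2 s, coset_cover L s & size s = n.
Proof.
move=> sL Ln.
have /finite_fsetP[X LX] : finite_set (left_cosets L) by apply/finite_setP; exists n.
have Xn : size (finmap.enum_fset X) = n by apply/card_eq_fsetP; rewrite -LX.
exists [seq (xget 1 A)^-1 | A <- finmap.enum_fset X]; last by rewrite size_map.
move=> x; pose A := [set x^-1 * y | y in L].
have AX : A \in finmap.enum_fset X.
  have : left_cosets L A by exists x^-1.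
  by rewrite LX.
exists (xget 1 A)^-1; first exact: map_f.
have [y Ly <-] : A (xget 1 A).
  by apply: (xgetI 1 (x := x^-1)); exists 1; [exact: subgroup1|rewrite mulg1].
by rewrite invgK mulVKg.
Qed.

(** The least size of a finite generating set is the rank, since an infinite competitor dominates
    every [I_r]. *)
Lemma ex_has_rank (G : groupType) (L : set G) (s : seq G) :
  generated [set` s] = L -> exists2 r, has_rank L r & (r <= size s)%N.
Proof.
move=> sL; pose P r := `[< exists S : set G, generated S = L /\ S #= `I_r >].
have /finite_fsetP[X sX] := finite_seq s.
have PX : P (size (finmap.enum_fset X)).
  by apply/asboolP; exists [set` s]; split=> //; rewrite sX; apply/card_eq_fsetP.
case: (ex_minnP (ex_intro P _ PX)) => r /asboolP Pr minr.
exists r; last first.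
  apply: leq_trans (minr _ PX) (uniq_leq_size (finmap.fset_uniq X) _) => x xX.
  by suff : [set` s] x by []; rewrite sX.
split=> // S SL; have [/finite_setP[k Sk]|/infiniteP Sinf] := pselect (finite_set S).
  rewrite (card_le_eqr Sk) card_le_II; apply: minr; apply/asboolP.
  by exists S.
by apply: card_le_trans Sinf; apply: subset_card_le.
Qed.

(* Logarithmic estimates and the rank bounds *)
Local Close Scope group_scope.
Local Close Scope card_scope.
Local Close Scope classical_set_scope.
Local Open Scope ring_scope.

(** This is [ln (1 + x) <= x] at [x = - 1 / 2]. *)
Lemma ln2_ge_half (R : realType) : 1 / 2 <= ln 2 :> R.
Proof.
have : ln (1 + - (1 / 2)) <= - (1 / 2) :> R by apply: le_ln1Dx; lra.
have -> : 1 + - (1 / 2) = 2^-1 :> R by lra.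
by rewrite lnV ?posrE // lerN2.
Qed.

(** Since [ln x <= x], the square of [ln x] is at most [x * ln x]. *)
Lemma ln_le_sqrt (R : realType) (x : R) : 1 <= x -> ln x <= Num.sqrt (x * ln x).
Proof.
move=> x1; have lx0 := ln_ge0 x1; have x0 : 0 < x by lra.
rewrite -[leLHS]ger0_norm // -sqrtr_sqr ler_wsqrtr // expr2.
by rewrite ler_wpM2r // ltW // ln_sublinear.
Qed.

Theorem theorem1p2 (R : realType) (m : nat) (hm : (0 < m)%N) (G : groupType)
  (hG : boundedly_generated m G) (L : set G) (hL : subgroup L)
  (n : nat) (hn : has_index L n) :
  exists r : nat,
    [/\ has_rank L r,
        r%:R <= 2 * m%:R ^+ 2 * Num.sqrt (n%:R * ln (n%:R : R)) + m%:R
      & normal_subgroup L ->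
        r%:R <= m%:R * (ln (n%:R : R) / ln 2) + m%:R].
Proof.
have [s Ls sn] := has_index_cover hL hn.
have n0 : (0 < n)%N by rewrite -sn; apply: coset_cover_gt0 Ls.
have [g gP] := hG.
have [l [l_size l_gen l_cover]] := bounded_product_cover hL Ls g 1%g.
have [||_ /mapP[p pl ->] /= [u pu un]] :=
  @neumann_cover G [seq (generated [set` p.1], p.2) | p <- l].
- by move=> _ /mapP[p _ ->]; apply: subgroup_generated.
- move=> x; have [a ->] := gP x; have [p pl pP] := l_cover a.
  exists (generated [set` p.1], p.2); first exact: map_f.
  by rewrite mul1g in pP.
have [pm pL] := l_gen p pl.
have [ts [tsL ts2]] := generated_extend hL (smallest_sub hL pL) pu.
have [r Lr rs] := ex_has_rank tsL.
have t2 : (2 ^ size ts <= n ^ m)%N.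
  by rewrite size_map in un; rewrite -sn (leq_trans ts2) // (leq_trans un).
have l2 := ln2_ge_half R; have l20 : 0 < ln 2 :> R by lra.
have m0 : 1 <= m%:R :> R by rewrite ler1n.
have n1 : 1 <= n%:R :> R by rewrite ler1n.
(* Take logarithms in [2 ^ size ts <= n ^ m]; the summand [m] counts the generators in [p.1]. *)
have bound : r%:R <= m%:R * (ln (n%:R : R) / ln 2) + m%:R.
  rewrite size_cat pm in rs.
  have : r%:R <= (size ts + m)%:R :> R by rewrite ler_nat.
  rewrite natrD => /le_trans; apply; rewrite lerD2r mulrA ler_pdivlMr //.
  have : ln ((2 ^ size ts)%:R : R) <= ln ((n ^ m)%:R : R).
    by rewrite ler_ln ?posrE ?ltr0n ?expn_gt0 ?n0 // ler_nat.
  by rewrite !natrX !lnXn ?ltr0n // !mulr_natl.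
exists r; split=> //; apply: le_trans bound _; rewrite lerD2r.
have lS := ln_le_sqrt n1; have l0 := ln_ge0 n1.
set S := Num.sqrt _ in lS *; set x := ln (n%:R : R) in lS l0 *.
have xl : x / ln 2 <= 2 * S by rewrite ler_pdivrMr //; nra.
apply: le_trans (ler_wpM2l _ xl) _; first by lra.
(* What remains is [m <= m ^ 2], from [1 <= m]. *)
rewrite mulrCA -mulrA ler_wpM2l // ler_wpM2r //; first by lra.
by rewrite expr2; nra.
Qed.
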